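(* Let $r\ge1$, let $\eta\in\mathcal{C}_r$ be a local configuration having at least one positive vertex, and let the potentials $a(n)<0$ and $b(n)\ge0$ satisfy: $n^dW_n(\eta)=\lambda$ for all $n$, for some constant $\lambda>0$; $a(n)+2\mathcal{V}b(n)\le0$; and $a(n)+\mathcal{V}b(n)\to-\infty$ as $n\to+\infty$. Let $(R(n))_n$ be a sequence of integers and $(W_n)_n$ a sequence of reals in $(0,1)$ such that $R(n)\to+\infty$, $W_n\to0$, and for every $n$ there exists $\zeta_n\in\mathcal{C}_r$ with $W_n=W_n(\zeta_n)$. Let $x$ be a vertex. Then $$\lim_{n\to+\infty}R(n)W_n^{1/d}=0\ \Longrightarrow\ \lim_{n\to+\infty}\mu_{a,b}\bigl(\mathcal{A}_r(x,R(n),W_n)\,\big|\,I_x^\eta=1\bigr)=0,$$ $$\lim_{n\to+\infty}R(n)W_n^{1/d}=+\infty\ \Longrightarrow\ \lim_{n\to+\infty}\mu_{a,b}\bigl(\mathcal{A}_r(x,R(n),W_n)\,\big|\,I_x^\eta=1\bigr)=1.$$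
   Context: Fix a dimension $d\ge1$, $1\le q\le\infty$ and an integer $\rho\ge1$. Let $V_n=\{0,\dots,n-1\}^d$ be the lattice torus (all operations on vertices are modulo $n$). Two vertices $x\ne y$ are neighbors, i.e. $\{x,y\}\in E_n$, iff $\|y-x\|_q\le\rho$ (subtraction componentwise modulo $n$); each vertex has the same number $\mathcal{V}$ of neighbors. $\mathrm{dist}$ is the graph distance of $G_n=(V_n,E_n)$ and $B(x,R)=\{y\in V_n:\mathrm{dist}(x,y)\le R\}$. To avoid self-overlapping balls it is always assumed that $n>2\rho R$ for the balls of radius $R$ considered (here $n>2\rho R(n)$). Configurations are elements $\sigma\in\mathcal{X}_n=\{-1,+1\}^{V_n}$. The Gibbs measure with potentials $a,b$ is $$\mu_{a,b}(\sigma)=\frac1{Z_{a,b}}\exp\Bigl(a\sum_{x\in V_n}\sigma(x)+b\sum_{\{x,y\}\in E_n}\sigma(x)\sigma(y)\Bigr),$$ with $Z_{a,b}$ the normalizing constant; the potentials $a=a(n)$, $b=b(n)$ depend on $n$ and $\mu_{a(n),b(n)}$ is still written $\mu_{a,b}$. Local configurations with radius $r$ ($r$ fixed, independent of $n$) are the elements $\eta$ of $\mathcal{C}_r=\{-1,+1\}^{B(0,r)}$. Let $V_+(\eta)=\{x\in B(0,r):\eta(x)=+1\}$, $k(\eta)=|V_+(\eta)|$, perimeter $\gamma(\eta)=\mathcal{V}\,k(\eta)-2\,|\{\{x,y\}\in E_n: x,y\in V_+(\eta)\}|$, and weight $W_n(\eta)=\exp(2a(n)k(\eta)-2b(n)\gamma(\eta))$.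 For $x\in V_n$, $I_x^\eta(\sigma)=1$ if the restriction of $\sigma$ to $B(x,r)$ is the translate of $\eta$ (i.e. $\sigma(x+y)=\eta(y)$ for all $y\in B(0,r)$) and $I_x^\eta(\sigma)=0$ otherwise. For $0<W<1$, $\mathcal{C}_r(W)=\{\zeta\in\mathcal{C}_r:W_n(\zeta)\le W\}$. The ring is $\mathcal{R}(x,s,R)=\{y\in V_n: s<\mathrm{dist}(x,y)\le R\}$. For $R\ge3r+1$ (so $R(n)\ge 3r+1$ is understood), $\mathcal{A}_r(x,R,W)$ is the event: there exist $y\in\mathcal{R}(x,2r,R-r)$ and $\zeta\in\mathcal{C}_r(W)$ such that $I_y^\zeta=1$. *)

(* Defs.v *)
From HB Require Import structures.
From mathcomp Require Import all_boot all_order all_algebra.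
From mathcomp Require Import all_classical all_reals all_analysis.

Set Implicit Arguments.
Unset Strict Implicit.
Unset Printing Implicit Defensive.

Import Order.TTheory GRing.Theory Num.Theory.
Import numFieldNormedType.Exports.

Local Open Scope classical_set_scope.
Local Open Scope ring_scope.

(* The torus {0, ..., n-1}^d. For n >= 1, ['I_n.-1.+1] is ['I_n]; writing the
   bound as a successor gives access to the canonical addition modulo n, hence
   to the componentwise one on [torus d n]. For n = 0 this is a single point. *)
Definition torus (d n : nat) := {ffun 'I_d -> 'I_n.-1.+1}.

(* The representative of z modulo n lying in ]-n/2, n/2]^d. *)
Definition centered (d n : nat) (z : torus d n) (i : 'I_d) : int :=
  if (2 * z i <= n)%N then (z i)%:Z else (z i)%:Z - n%:Z.

Definition torus_norm (R : realType) (q : \bar R) (d n : nat)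
    (z : torus d n) : R :=
  match q with
  | p%:E => (\sum_i `|(centered z i)%:~R| `^ p) `^ p^-1
  | _ => \big[Order.max/0]_i `|(centered z i)%:~R|
  end.

Definition adj (R : realType) (q : \bar R) (rho d n : nat)
    (x y : torus d n) : bool :=
  (x != y) && (torus_norm q (y - x) <= rho%:R).

Arguments adj {R} q rho {d n} x y.

Definition edges (R : realType) (q : \bar R) (rho d n : nat) :
    {set {set torus d n}} :=
  [set e : {set torus d n} |
    [exists x, [exists y, adj q rho x y && (e == [set x; y]%SET)]]]%SET.

(* The graph is vertex-transitive: the degree is read off at the origin. *)
Definition degree (R : realType) (q : \bar R) (rho d n : nat) : nat :=
  #|[set y : torus d n | adj q rho 0 y]%SET|.

(* Least length of a walk from x to y. Shortest walks have fewer than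
   #|torus d n| steps, so the search below succeeds whenever y is reachable
   from x (otherwise its value is #|torus d n|). *)
Definition graph_dist (R : realType) (q : \bar R) (rho d n : nat)
    (x y : torus d n) : nat :=
  find (fun k => [exists p : k.-tuple (torus d n),
                    path (adj q rho) x p && (last x p == y)])
       (iota 0 #|{: torus d n}|).

Definition graph_ball (R : realType) (q : \bar R) (rho d n : nat)
    (x : torus d n) (s : nat) : {set torus d n} :=
  [set y | (graph_dist q rho x y <= s)%N]%SET.

Definition graph_ring (R : realType) (q : \bar R) (rho d n : nat)
    (x : torus d n) (s t : nat) : {set torus d n} :=
  [set y | (s < graph_dist q rho x y <= t)%N]%SET.

(* Spins are encoded by booleans: [true] stands for +1, [false] for -1. *)
Definition spin (R : realType) (s : bool) : R := if s then 1 else -1.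

Definition config (d n : nat) := {ffun torus d n -> bool}.

(* The edge {x, y} contributes sigma(x) sigma(y), the product of the spins of
   its two (distinct) elements. *)
Definition boltzmann (R : realType) (q : \bar R) (rho d n : nat) (a b : R)
    (sigma : config d n) : R :=
  expR (a * (\sum_x spin R (sigma x)) +
        b * (\sum_(e in edges q rho d n) \prod_(x in e) spin R (sigma x))).

Definition gibbs (R : realType) (q : \bar R) (rho d n : nat) (a b : R)
    (A : {set config d n}) : R :=
  (\sum_(sigma in A) boltzmann q rho a b sigma) /
  (\sum_(sigma : config d n) boltzmann q rho a b sigma).

Definition gibbs_cond (R : realType) (q : \bar R) (rho d n : nat) (a b : R)
    (A B : {set config d n}) : R :=
  gibbs q rho a b (A :&: B)%SET / gibbs q rho a b B.

Definition local_config (R : realType) (q : \bar R) (rho r d n : nat) :=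
  {ffun {y : torus d n | y \in graph_ball q rho 0 r} -> bool}.

(* Two local configurations, on tori of possibly different sizes m and n, are
   the same if they agree on offsets with the same centered coordinates. When
   m, n > 2 rho r, both balls B(0, r) have the same centered coordinates, and
   this is the usual identification making {-1,+1}^B(0,r) independent of n. *)
Definition same_local_config (R : realType) (q : \bar R) (rho r d m n : nat)
    (eta : local_config q rho r d m) (eta' : local_config q rho r d n) : Prop :=
  forall y y', centered (val y) =1 centered (val y') -> eta y = eta' y'.

Definition positive_vertices (R : realType) (q : \bar R) (rho r d n : nat)
    (eta : local_config q rho r d n) : {set torus d n} :=
  [set val y | y in [set y | eta y]]%SET.

Definition perimeter (R : realType) (q : \bar R) (rho r d n : nat)
    (eta : local_config q rho r d n) : int :=
  (degree q rho d n * #|positive_vertices eta|)%:Z -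
  (2 * #|[set e in edges q rho d n | e \subset positive_vertices eta]%SET|)%:Z.

Definition weight (R : realType) (q : \bar R) (rho r d n : nat) (a b : R)
    (eta : local_config q rho r d n) : R :=
  expR (2 * a * #|positive_vertices eta|%:R - 2 * b * (perimeter eta)%:~R).

Definition occurs (R : realType) (q : \bar R) (rho r d n : nat)
    (x : torus d n) (eta : local_config q rho r d n) : {set config d n} :=
  [set sigma : config d n | [forall y, sigma (x + val y) == eta y]]%SET.

Definition light_configs (R : realType) (q : \bar R) (rho r d n : nat)
    (a b W : R) : {set local_config q rho r d n} :=
  [set zeta : local_config q rho r d n | weight a b zeta <= W]%SET.

(* The subtraction s - r is truncated; only s >= 3 r + 1 is meaningful. *)
Definition light_nearby (R : realType) (q : \bar R) (rho r d n : nat)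
    (a b : R) (x : torus d n) (s : nat) (W : R) : {set config d n} :=
  [set sigma : config d n |
    [exists y in graph_ring q rho x (2 * r) (s - r),
      [exists zeta in light_configs q rho r d n a b W,
        sigma \in occurs y zeta]]]%SET.

(* Main.v *)
(* Let A be the set of plus vertices of a configuration and let
   w(A) = exp(2 a |A| - 2 b |boundary of A|), so that the Gibbs measure is
   proportional to w. Adding a set S to A multiplies w by at most eps^|S| with
   eps = exp(2 (a + V b)), which tends to 0; moreover w(A u B) >= w(A) w(B) for
   disjoint A and B, with equality when no edge joins A to B.

   Upper bound. Given anything outside B(y, r+1), the pattern zeta occurs at y
   with probability at most C W(zeta): turning off the plus vertices of the
   shell B(y, r+1) \ B(y, r) costs at most a constant factor and decouples zeta
   from the rest. When dist(x, y) = 2 r + 1 this shell meets B(x, r), but there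
   are boundedly many such y and each contributes at most C eps. The union bound
   is O(eps + R^d W).

   Lower bound. Given anything outside B(y, r), zeta occurs at y with
   probability at least W(zeta) / C, so among N disjoint balls it is missed
   everywhere with probability at most (1 - W / C)^N, and the ring contains
   N >= c R^d disjoint balls. *)
Require Import Defs.
From HB Require Import structures.
From mathcomp Require Import all_boot all_order all_algebra.
From mathcomp Require Import all_classical all_reals all_analysis.
(* [finset] comes again last so that its names win over [classical_sets]. *)
From mathcomp Require Import fintype finset zify ring lra.

Set Implicit Arguments.
Unset Strict Implicit.
Unset Printing Implicit Defensive.

Import Order.TTheory GRing.Theory Num.Theory.
Import numFieldNormedType.Exports.

Local Open Scope ring_scope.

(** * Weights of sets of plus vertices *)

Section PlusSets.
Context (R : realType) (T : finType) (e : rel T) (V : nat) (a b : R).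
Hypothesis e_sym : symmetric e.
Hypothesis e_deg : forall x, #|[set y | e x y]%SET| = V.
Hypothesis b_ge0 : 0 <= b.
Hypothesis ab_le0 : a + V%:R * b <= 0.

Implicit Types A B C O S U Z : {set T}.

(** Ordered pairs instead of edges turn every count into a double sum; an edge with both ends in A
    and in B is counted twice. *)
Definition arcs A B : {set T * T} :=
  [set p in setX A B | e p.1 p.2]%SET.

Definition edge_cut A : nat := #|arcs A (~: A)|.

Definition plus_weight A : R := expR (2 * a * #|A|%:R - 2 * b * (edge_cut A)%:R).

Local Notation eps := (expR (2 * (a + V%:R * b))).
Local Notation w := plus_weight.

Lemma arcsP A B x y :
  ((x, y) \in arcs A B) = [&& x \in A, y \in B & e x y].
Proof. by rewrite !inE /= andbA. Qed.

Lemma card_arcs A B : #|arcs A B| = (\sum_(x in A) \sum_(y in B) e x y)%N.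
Proof.
rewrite pair_big_dep -sum1_card [LHS]big_mkcond [RHS]big_mkcond /=.
apply: eq_bigr => -[x y] _; rewrite arcsP /= andbA.
by case: ((x \in A) && (y \in B)) => //=; case: (e x y).
Qed.

Lemma card_arcsC A B : #|arcs A B| = #|arcs B A|.
Proof.
rewrite !card_arcs exchange_big; apply: eq_bigr => x _.
by apply: eq_bigr => y _; rewrite e_sym.
Qed.

Lemma card_arcsT A : #|arcs A setT| = (V * #|A|)%N.
Proof.
rewrite card_arcs mulnC -sum_nat_const; apply: eq_bigr => x _.
rewrite -(e_deg x) -sum1_card big_mkcond [RHS]big_mkcond /=.
by apply: eq_bigr => y _; rewrite !inE; case: (e x y).
Qed.

(** The V arcs out of each vertex of A end in A or outside it. Together with [card_arcs_edges] this
    identifies [edge_cut] with the perimeter. *)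
Lemma edge_cut_arcs A : (edge_cut A + #|arcs A A| = V * #|A|)%N.
Proof.
rewrite -card_arcsT addnC -cardsUI.
rewrite (_ : _ :&: _ = set0)%SET ?cards0 ?addn0.
  congr #|pred_of_set _|; apply/setP => -[x y]; rewrite ?in_setU ?in_setI !arcsP !inE.
  by case: (x \in A); case: (y \in A); case: (e x y).
apply/setP => -[x y]; rewrite ?in_setU ?in_setI !arcsP !inE.
by case: (x \in A); case: (y \in A); case: (e x y).
Qed.

(** An arc leaving A either still leaves the union or ends in S, and V |S| arcs end in S. *)
Lemma edge_cut_leU A S : (edge_cut A <= edge_cut (A :|: S) + V * #|S|)%N.
Proof.
rewrite -card_arcsT card_arcsC -cardsUI; apply: leq_trans (leq_addr _ _).
apply/subset_leq_card/subsetP => -[x y].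
rewrite ?in_setU ?in_setI !arcsP !inE /= => /and3P[-> /= yA ->]; rewrite andbT (negbTE yA) /=.
by case: (y \in S).
Qed.

Lemma edge_cutU_le A B : (edge_cut (A :|: B) <= edge_cut A + edge_cut B)%N.
Proof.
rewrite -cardsUI; apply: leq_trans (leq_addr _ _).
apply/subset_leq_card/subsetP => -[x y].
rewrite ?in_setU ?in_setI !arcsP !inE /= negb_or => /and3P[AB /andP[-> ->] ->].
by rewrite !andbT.
Qed.

(** With no arc between A and B, an arc leaving one of them cannot end in the other, so it leaves
    the union. *)
Lemma edge_cutU_ge A B : [disjoint A & B] ->
  {in A & B, forall x y, ~~ e x y} -> (edge_cut A + edge_cut B <= edge_cut (A :|: B))%N.
Proof.
move=> dAB nAB; rewrite -cardsUI (_ : _ :&: _ = set0)%SET ?cards0 ?addn0.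
  apply/subset_leq_card/subsetP => -[x y].
  rewrite ?in_setU ?in_setI !arcsP !inE /= negb_or.
  case/orP => /and3P[xA yA exy]; rewrite xA exy yA ?orbT ?andbT ?andTb.
    by apply/negP => yB; have := nAB _ _ xA yB; rewrite exy.
  by apply/negP => yB; have := nAB _ _ yB xA; rewrite e_sym exy.
apply/setP => -[x y]; rewrite ?in_setU ?in_setI !arcsP !inE.
by apply/negP => /andP[/and3P[xA _ _] /and3P[xB _ _]]; rewrite (disjointFr dAB xA) in xB.
Qed.

Lemma plus_weight_gt0 A : 0 < w A. Proof. exact: expR_gt0. Qed.

(** The exponent gains 2 a |S|, and the cut drops by at most V |S|, which gives back at most 2 b V
    |S|. *)
Lemma plus_weightU A S : [disjoint A & S] -> w (A :|: S) <= eps ^+ #|S| * w A.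
Proof.
move=> dAS; rewrite -expRM_natl -expRD ler_expR cardsU.
rewrite (_ : A :&: S = set0)%SET; last by apply/eqP; rewrite setI_eq0.
rewrite cards0 subn0 natrD.
have := edge_cut_leU A S; rewrite -(ler_nat R) natrD natrM => h.
have := ler_wpM2l b_ge0 h; rewrite -mulr_natr !mulrDr.
lra.
Qed.

Lemma eps_le1 : eps <= 1.
Proof. by rewrite -[leRHS]expR0 ler_expR; move: ab_le0; lra. Qed.

Lemma plus_weightU_le A S : [disjoint A & S] -> w (A :|: S) <= w A.
Proof.
move=> /plus_weightU /le_trans; apply.
by rewrite ler_piMl ?exprn_ile1 ?eps_le1 ?expR_ge0.
Qed.

Lemma plus_weightU_eps A S : [disjoint A & S] -> S != set0%SET ->
  w (A :|: S) <= eps * w A.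
Proof.
move=> /plus_weightU /le_trans h S0; apply: h.
rewrite ler_pM2r ?plus_weight_gt0 //.
have: (0 < #|S|)%N by rewrite card_gt0.
case: #|S| => // k _; rewrite exprS ler_piMr ?exprn_ile1 ?eps_le1 ?expR_ge0 //.
Qed.

Lemma plus_weightM_le A B : [disjoint A & B] -> w A * w B <= w (A :|: B).
Proof.
move=> dAB; rewrite -expRD ler_expR cardsU.
rewrite (_ : A :&: B = set0)%SET; last by apply/eqP; rewrite setI_eq0.
rewrite cards0 subn0 natrD.
have := edge_cutU_le A B; rewrite -(ler_nat R) natrD => h.
have := ler_wpM2l b_ge0 h; rewrite !mulrDr.
lra.
Qed.

Lemma plus_weightM_ge A B : [disjoint A & B] ->
  {in A & B, forall x y, ~~ e x y} -> w (A :|: B) <= w A * w B.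
Proof.
move=> dAB nAB; rewrite -expRD ler_expR cardsU.
rewrite (_ : A :&: B = set0)%SET; last by apply/eqP; rewrite setI_eq0.
rewrite cards0 subn0 natrD.
have := edge_cutU_ge dAB nAB; rewrite -(ler_nat R) natrD => h.
have := ler_wpM2l b_ge0 h; rewrite !mulrDr.
lra.
Qed.

(* [Ev] is an event determined by the spins outside [B]. *)
Definition off B (Ev : {set {set T}}) := forall A, (A :\: B \in Ev)%SET = (A \in Ev).

(** The unnormalized Gibbs measure; quotients of masses are conditional probabilities. *)
Definition mass (Ev : {set {set T}}) : R := \sum_(A in Ev) w A.

Definition seen B Z : {set {set T}} := [set A : {set T} | A :&: B == Z]%SET.

Lemma mass_ge0 Ev : 0 <= mass Ev.
Proof. by apply: sumr_ge0 => A _; rewrite ltW ?plus_weight_gt0. Qed.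

Lemma mass_gt0 (Ev : {set {set T}}) A : A \in Ev -> 0 < mass Ev.
Proof.
move=> AE; rewrite /mass (bigD1 A) //= ltr_pwDl ?plus_weight_gt0 //.
by apply: sumr_ge0 => B _; rewrite ltW ?plus_weight_gt0.
Qed.

Lemma massS (E1 E2 : {set {set T}}) : E1 \subset E2 -> mass E1 <= mass E2.
Proof.
move=> s12; rewrite /mass (big_setID E1 (A := E2)) /= (setIidPr s12) lerDl.
exact: mass_ge0.
Qed.

(** Split A into O, its part outside B, and S, its part inside; membership in [Ev] depends on O
    alone, so S runs over all subsets of B. *)
Lemma sum_off B (Ev : {set {set T}}) (f : {set T} -> R) : off B Ev ->
  \sum_(A in Ev) f A =
  \sum_(O in Ev | [disjoint O & B]) \sum_(S : {set T} | S \subset B) f (O :|: S)%SET.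
Proof.
move=> oEv.
rewrite (partition_big (fun A => A :\: B)%SET
  (fun O => (O \in Ev) && [disjoint O & B])) /=; last first.
  move=> A AE; rewrite oEv AE /= -setI_eq0; apply/eqP/setP => x.
  by rewrite !inE; case: (x \in A); case: (x \in B).
apply: eq_bigr => O /andP[OE dOB].
rewrite (reindex_onto (fun S => O :|: S)%SET (fun A => A :&: B)%SET); last first.
  by move=> A /andP[_ /eqP <-]; rewrite setUC setID.
apply: eq_bigl => S.
have O1 : (O :&: B = set0)%SET by apply/eqP; rewrite setI_eq0.
have O2 : (O :\: B = O)%SET by apply/setDidPl.
rewrite setDUl O2 setIUl O1 set0U.
apply/idP/idP => [/andP[_ /eqP <-]|SB]; first exact: subsetIr.
have SB0 : (S :\: B = set0)%SET by apply/eqP; rewrite setD_eq0.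
rewrite SB0 setU0 eqxx andbT (setIidPl SB) eqxx andbT.
by rewrite -oEv setDUl O2 SB0 setU0.
Qed.

(** For each O outside U there are at most 2^|U| configurations inside, each worth at most c w(O).
    The sets O are themselves members of [Ev], so their weights sum to at most [mass Ev]. *)
Lemma mass_seen_le U B Z (Ev : {set {set T}}) (c : R) : off U Ev -> B \subset U ->
  (forall O S, [disjoint O & U] -> S \subset U -> S :&: B = Z ->
    w (O :|: S) <= c * w O) -> 0 <= c ->
  mass (Ev :&: seen B Z)%SET <= 2 ^+ #|U| * c * mass Ev.
Proof.
move=> oEv BU h c0; rewrite /mass.
under eq_bigl do rewrite inE; rewrite big_mkcondr /= (sum_off _ oEv).
apply: (@le_trans _ _ (\sum_(O in Ev | [disjoint O & U]) 2 ^+ #|U| * c * w O)).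
  apply: ler_sum => O /andP[OE dOU].
  have -> : 2 ^+ #|U| * c * w O = \sum_(S : {set T} | S \subset U) c * w O.
    rewrite sumr_const -[RHS]mulr_natl -mulrA; congr (_ * _).
    by rewrite (eq_card (B := powerset U)) ?card_powerset ?natrX // => S; rewrite !inE.
  apply: ler_sum => S SU; case: ifP => [|_]; last first.
    by rewrite mulr_ge0 // ltW ?plus_weight_gt0.
  rewrite inE setIUl (_ : O :&: B = set0)%SET ?set0U => [/eqP|].
    by move/h; apply.
  by apply/eqP; rewrite setI_eq0 (disjointWr BU).
rewrite -mulr_sumr ler_wpM2l ?mulr_ge0 ?exprn_ge0 //.
by rewrite big_mkcondr /=; apply: ler_sum => A _; case: ifP => // _; rewrite ltW ?plus_weight_gt0.
Qed.

(** A nonempty Z means at least one plus vertex in B, which costs a factor [eps] against the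
    configuration with B all minus. *)
Lemma mass_seen_le_eps B Z (Ev : {set {set T}}) : off B Ev -> Z != set0%SET ->
  mass (Ev :&: seen B Z)%SET <= 2 ^+ #|B| * eps * mass Ev.
Proof.
move=> oEv Z0; apply: mass_seen_le (expR_ge0 _) => // O S dOB SB SZ.
apply: plus_weightU_eps (disjointWr SB dOB) _.
by rewrite -(setIidPl SB) SZ.
Qed.

(** U is B with a collar that no edge from B crosses. Erasing the plus vertices of the collar does
    not decrease the weight, and leaves Z without an edge to O, so the weight factorizes. *)
Lemma mass_seen_le_weight U B Z (Ev : {set {set T}}) : off U Ev -> B \subset U ->
  {in B, forall x y, y \notin U -> ~~ e x y} ->
  mass (Ev :&: seen B Z)%SET <= 2 ^+ #|U| * w Z * mass Ev.
Proof.
move=> oEv BU sep; apply: mass_seen_le => //; last by rewrite ltW ?plus_weight_gt0.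
move=> O S dOU SU SZ.
have ZB : Z \subset B by rewrite -SZ subsetIr.
have -> : (O :|: S = (O :|: Z) :|: (S :\: B))%SET by rewrite -SZ -setUA setID.
apply: le_trans (plus_weightU_le _) _.
  rewrite -setI_eq0; apply/eqP/setP => x; rewrite !inE.
  apply/negP => /andP[/orP[xO|xZ] /andP[xB xS]].
    by have := subsetP SU x xS; rewrite (disjointFr dOU xO).
  by rewrite (subsetP ZB x xZ) in xB.
rewrite mulrC; apply: plus_weightM_ge.
  by apply: disjointWr (subset_trans ZB BU) dOU.
move=> x y xO yZ; rewrite e_sym; apply: sep; first exact: (subsetP ZB).
by rewrite (disjointFr dOU xO).
Qed.

(** Given O outside B, all 2^|B| fillings of B together weigh at most 2^|B| w(O), while the filling
    Z alone weighs at least w(O) w(Z). *)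
Lemma mass_seen_ge B Z (Ev : {set {set T}}) : off B Ev -> Z \subset B ->
  w Z / 2 ^+ #|B| * mass Ev <= mass (Ev :&: seen B Z)%SET.
Proof.
move=> oEv ZB; rewrite /mass.
under [leRHS]eq_bigl do rewrite inE.
rewrite [leRHS]big_mkcondr /= (sum_off _ oEv) (sum_off _ oEv) mulr_sumr.
apply: ler_sum => O /andP[OE dOB].
apply: (@le_trans _ _ (w O * w Z)).
  have : \sum_(S : {set T} | S \subset B) w (O :|: S) <= 2 ^+ #|B| * w O.
    have -> : 2 ^+ #|B| * w O = \sum_(S : {set T} | S \subset B) w O.
      rewrite sumr_const -[RHS]mulr_natl; congr (_ * _).
      rewrite (eq_card (B := powerset B)) ?card_powerset ?natrX // => S.
      by rewrite !inE.
    by apply: ler_sum => S SB; apply/plus_weightU_le/disjointWr/dOB.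
  move=> h; rewrite mulrAC ler_pdivrMr ?exprn_gt0 // [w O * _]mulrC -mulrA.
  by rewrite ler_pM2l ?plus_weight_gt0 // [leRHS]mulrC.
rewrite (bigD1 Z) //= [X in _ <= (if X then _ else _) + _]inE setIUl.
rewrite (_ : O :&: B = set0)%SET ?set0U; last by apply/eqP; rewrite setI_eq0.
rewrite (setIidPl ZB) eqxx -[leLHS]addr0 lerD //.
  exact/plus_weightM_le/disjointWr/dOB.
by apply: sumr_ge0 => S _; case: ifP => // _; rewrite ltW ?plus_weight_gt0.
Qed.

Lemma off_setI B (E1 E2 : {set {set T}}) : off B E1 -> off B E2 ->
  off B (E1 :&: E2).
Proof. by move=> o1 o2 A; rewrite !inE o1 o2. Qed.

Lemma off_seen B C Z : [disjoint B & C] -> off B (seen C Z).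
Proof.
move=> dBC A; rewrite !inE; congr (_ == _); apply/setP => x; rewrite !inE.
by have [xB|//] := boolP (x \in B); rewrite (disjointFr dBC xB) !andbF.
Qed.

Lemma off_unseen B C Z : [disjoint B & C] -> off B (~: seen C Z).
Proof. by move=> dBC A; rewrite !in_setC off_seen. Qed.

(* The factor [2 ^+ K] bounds the partition function of the spins in [B i]. *)
Lemma mass_unseen_le (I : eqType) (s : seq I) (B Z : I -> {set T})
    (Ev : {set {set T}}) (W : R) (K : nat) :
  uniq s -> {in s &, forall i j, i != j -> [disjoint B i & B j]} ->
  {in s, forall i, [/\ off (B i) Ev, Z i \subset B i, W <= w (Z i) &
     (#|B i| <= K)%N]} -> 0 <= W <= 1 ->
  mass (Ev :&: [set A | all (fun i => A \notin seen (B i) (Z i)) s]) <=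
  (1 - W / 2 ^+ K) ^+ size s * mass Ev.
Proof.
move=> us dB hs /andP[W0 W1].
(* The induction also carries that missing the sets already treated is an event off every set
   disjoint from them; this lets [mass_seen_ge] apply to the next one. *)
suff [] : mass (Ev :&: [set A | all (fun i => A \notin seen (B i) (Z i)) s]) <=
  (1 - W / 2 ^+ K) ^+ size s * mass Ev /\
  forall C, off C Ev -> {in s, forall i, [disjoint C & B i]} ->
  off C (Ev :&: [set A | all (fun i => A \notin seen (B i) (Z i)) s]) by [].
elim: s us dB hs => [|i s IH] /=; [move=> _ _ _|case/andP=> is_ us dB hs].
  rewrite mul1r; split; first by apply: massS; rewrite subsetIl.
  by move=> C oC _; apply: off_setI => // A; rewrite !inE.
have ls : {in s, forall j, j \in i :: s} by move=> j js; rewrite inE js orbT.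
have [IH1 IH2] := IH us (fun j k js ks => dB j k (ls j js) (ls k ks))
  (fun j js => hs j (ls j js)).
set F := Ev :&: _ in IH1 IH2.
have -> : Ev :&: [set A | (A \notin seen (B i) (Z i)) &&
    all (fun j => A \notin seen (B j) (Z j)) s] = F :&: ~: seen (B i) (Z i).
  by apply/setP => A; rewrite !inE andbA andbAC.
have [oEv ZB WZ BK] := hs i (mem_head _ _).
split; last first.
  move=> C oC dC; apply: off_setI.
    by apply: IH2 => // j /ls; apply: dC.
  by apply: off_unseen; apply: dC; apply: mem_head.
have oF : off (B i) F.
  apply: IH2 => // j js; apply: dB; rewrite ?mem_head ?ls //.
  by apply: contraNneq is_ => ->.
have : mass F = mass (F :&: seen (B i) (Z i)) + mass (F :&: ~: seen (B i) (Z i)).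
  by rewrite /mass (big_setID (seen (B i) (Z i))) setDE.
have := mass_seen_ge oF ZB.
have : W / 2 ^+ K * mass F <= w (Z i) / 2 ^+ #|B i| * mass F.
  rewrite ler_wpM2r ?mass_ge0 // ler_pM ?invr_ge0 ?exprn_ge0 //.
  by rewrite lef_pV2 ?posrE ?exprn_gt0 // ler_weXn2l // ler1n.
move=> h1 h2 h3.
have {h1 h2 h3} : mass (F :&: ~: seen (B i) (Z i)) <= (1 - W / 2 ^+ K) * mass F.
  by rewrite mulrBl mul1r; lra.
move=> /le_trans; apply; rewrite exprS -mulrA ler_wpM2l //.
rewrite subr_ge0 ler_pdivrMr ?exprn_gt0 // mul1r (le_trans W1) //.
by rewrite exprn_ege1 // ler1n.
Qed.

Lemma mass_compl Ev (E' : {set {set T}}) :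
  mass (Ev :&: E') = mass Ev - mass (Ev :\: E').
Proof. by rewrite /mass (big_setID E' (A := Ev)) /= addrK. Qed.

Lemma mass_bigcup (I : finType) (P : pred I) (E : I -> {set {set T}}) Ev :
  mass (Ev :&: \bigcup_(i | P i) E i) <= \sum_(i | P i) mass (Ev :&: E i).
Proof.
apply: (big_ind2 (fun (E' : {set {set T}}) (m : R) => mass (Ev :&: E') <= m)).
- by rewrite setI0 /mass big_set0.
- move=> E1 m1 E2 m2 h1 h2; apply: le_trans (lerD h1 h2).
  rewrite setIUr /mass; set X := Ev :&: E1; set Y := Ev :&: E2.
  rewrite (big_setID X (A := X :|: Y)) /= setUK lerD //.
  apply: massS; by apply/subsetP => A; rewrite in_setD in_setU; case: (A \in X).
- by move=> i _; exact: lexx.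
Qed.
End PlusSets.

(** * Edge sums as sums over ordered pairs *)

(** The body of [edges] for an arbitrary relation, so that double counting is done without the
    torus. *)
Definition edge_set (T : finType) (e : rel T) : {set {set T}} :=
  [set E : {set T} | [exists x, [exists y, e x y && (E == [set x; y])]]].

Section EdgeSums.
Context (R : realType) (T : finType) (e : rel T).
Hypothesis e_sym : symmetric e.
Hypothesis e_irr : irreflexive e.

(** The fibre over an edge {x, y} consists of (x, y) and (y, x), which differ by irreflexivity. *)
Lemma sum_edge_set (F : {set T} -> R) :
  \sum_(p : T * T | e p.1 p.2) F [set p.1; p.2] =
  2 * \sum_(E in edge_set e) F E.
Proof.
rewrite (partition_big (fun p : T * T => [set p.1; p.2]) (mem (edge_set e))) /=.
  rewrite mulr_sumr; apply: eq_bigr => E.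
  rewrite inE => /existsP[x /existsP[y /andP[exy /eqP ->{E}]]].
  have xy : x != y by apply: contraTneq exy => ->; rewrite e_irr.
  rewrite (eq_bigr (fun=> F [set x; y])); last by move=> p /andP[_ /eqP ->].
  rewrite (eq_bigl (mem [set (x, y); (y, x)])) => [|[u v] /=].
    by rewrite sumr_const cards2 xpair_eqE negb_and xy /= mulr_natl.
  rewrite !inE !xpair_eqE; apply/andP/orP.
    move=> [euv /eqP/setP h]; have uv : u != v.
      by apply: contraTneq euv => ->; rewrite e_irr.
    have := h u; have := h v; have := h x; have := h y; rewrite !inE !eqxx /= !orbT.
    move=> hy hx /esym hv /esym hu; move: hy hx.
    case/orP: hu => /eqP hu; case/orP: hv => /eqP hv; subst u v;
      rewrite ?eqxx ?orbT //=.
    - by rewrite eqxx in uv.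
    - by left.
    - by right.
    - by rewrite eqxx in uv.
  by case=> /andP[/eqP -> /eqP ->]; rewrite ?exy ?(e_sym y) ?exy ?eqxx // setUC.
move=> [x y] /= exy; rewrite inE; apply/existsP; exists x; apply/existsP; exists y.
by rewrite exy eqxx.
Qed.

Lemma card_arcs_edges (A : {set T}) :
  #|arcs e A A| = (2 * #|[set E in edge_set e | E \subset A]|)%N.
Proof.
apply/eqP; rewrite -(eqr_nat R) natrM -!sum1_card !natr_sum; apply/eqP.
under [X in _ = _ * X]eq_bigl do rewrite inE.
rewrite big_mkcondr /= -sum_edge_set [LHS]big_mkcond [RHS]big_mkcond /=.
apply: eq_bigr => -[x y] _; rewrite arcsP subUset !sub1set /=.
by case: (x \in A); case: (y \in A); case: (e x y).
Qed.

Lemma sum_spin (A : {set T}) (sigma : {ffun T -> bool}) :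
  (forall x, (x \in A) = sigma x) ->
  \sum_x spin R (sigma x) = 2 * #|A|%:R - #|T|%:R.
Proof.
have -> : #|T|%:R = \sum_(x : T) (1 : R) by rewrite sumr_const.
move=> hA; rewrite -sum1_card natr_sum [in RHS]big_mkcond mulr_sumr -sumrB.
apply: eq_bigr => x _.
by rewrite hA /spin; case: (sigma x); lra.
Qed.

(** An edge contributes 1, or -1 if it is cut; a cut edge gives one arc out of A and one arc into
    A. *)
Lemma sum_edge_spin (A : {set T}) (sigma : {ffun T -> bool}) :
  (forall x, (x \in A) = sigma x) ->
  \sum_(E in edge_set e) \prod_(x in E) spin R (sigma x) =
  #|edge_set e|%:R - 2 * (edge_cut e A)%:R.
Proof.
move=> hA; apply: (@mulfI _ 2); first by rewrite pnatr_eq0.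
rewrite -sum_edge_set mulrBr -[#|edge_set e|]sum1_card natr_sum -sum_edge_set.
have -> : 2 * (2 * (edge_cut e A)%:R) = 2 * ((edge_cut e A)%:R + #|arcs e (~: A) A|%:R) :> R.
  by rewrite -(card_arcsC e_sym) /edge_cut; lra.
rewrite /edge_cut -!sum1_card !natr_sum [X in 2 * (X + _)]big_mkcond [X in 2 * (_ + X)]big_mkcond.
rewrite -big_split mulr_sumr [LHS]big_mkcond [X in X - _]big_mkcond -sumrB.
apply: eq_bigr => -[x y] _ /=; rewrite !arcsP !inE !hA.
case: ifP => exy; last by rewrite !andbF /=; lra.
have xy : x != y by apply: contraTneq exy => ->; rewrite e_irr.
rewrite big_setU1 ?inE //= big_set1 /spin.
by case: (sigma x); case: (sigma y) => /=; lra.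
Qed.
End EdgeSums.

(** * Geometry of the torus graph *)

(** The distance from the i-th coordinate to 0 on the cycle of length n; a natural number form of
    the absolute value of [centered]. *)
Definition cyclic_abs (d n : nat) (z : torus d n) (i : 'I_d) : nat :=
  minn (z i) (n - z i).

Section TorusGraph.
Context (R : realType) (q : \bar R) (rho d n : nat).
Hypothesis hq : (1 <= q)%E.
Hypothesis hn : (1 < n)%N.

Implicit Types (x y z t : torus d n) (i : 'I_d).

Let n_gt0 : (0 < n)%N. Proof. exact: ltnW. Qed.

Lemma ltn_torus z i : (z i < n)%N.
Proof. by rewrite -[X in (_ < X)%N](prednK n_gt0). Qed.

Lemma torusDE y z i : (y + z) i = ((y i + z i) %% n)%N :> nat.
Proof. by rewrite ffunE /=; congr (_ %% _)%N; exact: prednK. Qed.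

Lemma torusNE z i : (- z) i = ((n - z i) %% n)%N :> nat.
Proof. by rewrite ffunE /=; congr ((_ - _) %% _)%N; exact: prednK. Qed.

Lemma cyclic_absD y z i : (cyclic_abs (y + z)%R i <= cyclic_abs y i + cyclic_abs z i)%N.
Proof.
rewrite /cyclic_abs torusDE; have := ltn_torus y i; have := ltn_torus z i.
move: (y i : nat) (z i : nat) => u v hv hu; case: (ltnP (u + v) n) => h.
  by rewrite modn_small //; lia.
have -> : ((u + v) %% n = u + v - n)%N.
  by rewrite -{1}(subnK h) modnDr modn_small //; lia.
lia.
Qed.

Lemma cyclic_absN z i : cyclic_abs (- z) i = cyclic_abs z i.
Proof.
rewrite /cyclic_abs torusNE; have := ltn_torus z i.
move: (z i : nat) => [|u] hu; first by rewrite subn0 modnn; lia.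
rewrite modn_small; lia.
Qed.

Lemma abs_centered z i : `|(centered z i)%:~R| = (cyclic_abs z i)%:R :> R.
Proof.
rewrite /centered /cyclic_abs; have := ltn_torus z i.
move: (z i : nat) => u hu; case: ifP => h.
  by rewrite (minn_idPl _) ?normr_nat //; lia.
rewrite (minn_idPr _); last by lia.
by rewrite -intr_norm distrC subzn ?(ltnW hu).
Qed.

(** [centered] is not odd at the coordinate n/2, but its absolute value is invariant under
    negation. *)
Lemma torus_normN z : torus_norm q (- z) = torus_norm q z.
Proof.
rewrite /torus_norm; case: q => [p||]; [congr (_ `^ _)|..];
  by apply: eq_bigr => i _; rewrite !abs_centered cyclic_absN.
Qed.

Lemma cyclic_abs_le_norm z i : (cyclic_abs z i)%:R <= torus_norm q z.
Proof.
rewrite /torus_norm -abs_centered; move: hq; case: q => [p||//] hp; last first.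
  by rewrite (bigD1 i) //= le_max lexx.
have p0 : 0 < p by rewrite (lt_le_trans ltr01) // -lee_fin.
have {1}-> : `|(centered z i)%:~R| = (`|(centered z i)%:~R| `^ p) `^ p^-1 :> R.
  by rewrite -powRrM divff ?gt_eqF // powRr1.
rewrite ge0_ler_powR ?invr_ge0 ?(ltW p0) // ?nnegrE ?powR_ge0 //.
  by apply: sumr_ge0 => j _; exact: powR_ge0.
by rewrite (bigD1 i) //= lerDl; apply: sumr_ge0 => j _; exact: powR_ge0.
Qed.

Local Notation adj := (@adj R q rho d n).

Lemma adj_sym : symmetric adj.
Proof. by move=> x y; rewrite /Defs.adj eq_sym -(opprB x y) torus_normN. Qed.

Lemma adj_irr : irreflexive adj.
Proof. by move=> x; rewrite /Defs.adj eqxx. Qed.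

Lemma adj_translate t x y : adj (t + x) (t + y) = adj x y.
Proof.
by rewrite /Defs.adj (inj_eq (addrI t)) opprD addrACA subrr add0r.
Qed.

Lemma card_adj x : #|[set y | adj x y]| = degree q rho d n.
Proof.
rewrite /degree -[RHS](card_imset _ (addrI x)); congr #|pred_of_set _|.
apply/setP => y; rewrite inE; apply/idP/imsetP => [xy|[z]].
  by exists (y - x); rewrite ?inE ?subrKC // -(adj_translate x) addr0 subrKC.
by rewrite inE => z0 ->; rewrite -{1}[x]addr0 adj_translate.
Qed.

Lemma adj_cyclic_abs x y i : adj x y -> (cyclic_abs (y - x)%R i <= rho)%N.
Proof.
by move=> /andP[_]; rewrite -(ler_nat R); apply: le_trans; exact: cyclic_abs_le_norm.
Qed.

(** Walks can be concatenated, reversed and translated directly, unlike the bounded search in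
    [graph_dist]; [graph_distP] links the two. *)
Definition reach (k : nat) x y : Prop :=
  exists p, [/\ (size p <= k)%N, path adj x p & last x p = y].

Lemma reachW k l x y : (k <= l)%N -> reach k x y -> reach l x y.
Proof. by move=> kl [p [pk xp py]]; exists p; split=> //; exact: leq_trans kl. Qed.

Lemma reach0 x : reach 0 x x.
Proof. by exists [::]. Qed.

Lemma reach_trans k l x y z : reach k x y -> reach l y z -> reach (k + l) x z.
Proof.
move=> [p [pk xp py]] [s [sl ys sz]]; exists (p ++ s).
by rewrite size_cat leq_add // cat_path last_cat xp py ys.
Qed.

Lemma reach_sym k x y : reach k x y -> reach k y x.
Proof.
move=> [p [pk xp <-]]; exists (rev (belast x p)); rewrite size_rev size_belast.
rewrite rev_path -(eq_path (e := adj)) ?xp; last by move=> u v; exact: adj_sym.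
by split=> //; case: p {pk xp} => //= u p; rewrite rev_cons last_rcons.
Qed.

Lemma reach_translate k t x y : reach k x y -> reach k (t + x) (t + y).
Proof.
move=> [p [pk xp <-]]; exists (map (+%R t) p); rewrite size_map last_map.
split=> //; rewrite path_map; apply: sub_path xp => u v /=.
by rewrite adj_translate.
Qed.

Lemma reach_step x y : adj x y -> reach 1 x y.
Proof. by move=> xy; exists [:: y]; rewrite /= xy. Qed.

(** One step moves each coordinate by at most [rho] around the cycle. This is the source of all
    lower bounds on distances. *)
Lemma reach_cyclic_abs k x y i : reach k x y -> (cyclic_abs (y - x)%R i <= rho * k)%N.
Proof.
move=> [p [pk xp <-]]; apply: leq_trans (_ : rho * size p <= _)%N; last first.
  by rewrite leq_mul2l pk orbT.
elim: p x xp {pk} => [|u p IH] x /=.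
  by rewrite subrr /cyclic_abs ffunE /= min0n.
move=> /andP[xu up]; rewrite mulnS -(subrKA u) addnC addrC.
apply: leq_trans (cyclic_absD _ _ _) _; rewrite addnC.
by rewrite leq_add ?adj_cyclic_abs // IH.
Qed.

(** The bound on k keeps it inside the searched range, so that a value at most k comes from an
    actual walk and not from the default of [find]. *)
Lemma graph_distP k x y : (k < #|{: torus d n}|)%N ->
  reflect (reach k x y) (graph_dist q rho x y <= k)%N.
Proof.
move=> kN; rewrite /graph_dist; set P := fun k => _; apply: (iffP idP) => [h|].
  have hN : has P (iota 0 #|{: torus d n}|).
    by rewrite has_find size_iota (leq_ltn_trans h).
  have := nth_find 0 hN; rewrite nth_iota ?add0n; last by rewrite (leq_ltn_trans h).
  move=> /existsP[p /andP[xp /eqP py]]; exists p; rewrite size_tuple; split=> //.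
move=> [p [pk xp py]]; case/shortenP: xp py => p' xp' /= /andP[_ /uniq_leq_size up'] /up' pp' py.
rewrite leqNgt; apply/negP => kf.
have pf : (size p' < find P (iota 0 #|{: torus d n}|))%N.
  by rewrite (leq_ltn_trans pp') // (leq_ltn_trans pk).
have := before_find 0 pf; rewrite nth_iota ?add0n; last first.
  by rewrite (leq_ltn_trans pp') // (leq_ltn_trans pk).
by move=> /existsP[]; exists (in_tuple p'); rewrite xp' py eqxx.
Qed.

(** * Volume bounds and axis-parallel walks *)

Lemma card_cyclic_abs_le K :
  (#|[set z : torus d n | [forall i, (cyclic_abs z i <= K)%N]]| <= (2 * K + 1) ^ d)%N.
Proof.
pose I := [set u : 'I_n.-1.+1 | (minn u (n - u) <= K)%N].
have cI : (#|I| <= 2 * K + 1)%N.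
  apply: leq_trans (_ : #|[set: 'I_(2 * K + 1)]| <= _)%N; last first.
    by rewrite cardsT card_ord.
  (* The residues u <= K are kept; the others have 1 <= n - u <= K and go to K+1, ..., 2K. *)
  pose f (u : 'I_n.-1.+1) : 'I_(2 * K).+1 :=
    inord (if (u <= K)%N then u : nat else (K + (n - u))%N).
  have fE u : u \in I -> f u = (if (u <= K)%N then u : nat else (K + (n - u))%N) :> nat.
    rewrite inE => uK; rewrite inordK //; case: ifP uK; lia.
  rewrite addn1 -(card_in_imset (f := f)) ?subset_leq_card ?subsetT // => u v uI vI.
  move/(congr1 val); rewrite /= !fE // => h; apply: val_inj => /=.
  have un : (u < n)%N by rewrite -[X in (_ < X)%N](prednK n_gt0).
  have vn : (v < n)%N by rewrite -[X in (_ < X)%N](prednK n_gt0).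
  by move: h; case: ifP => ?; case: ifP => ?; lia.
apply: leq_trans (_ : #|I| ^ d <= _)%N; last by elim: (d) => // k IH; rewrite !expnS leq_mul.
rewrite -[X in (_ ^ X)%N]card_ord -card_ffun_on; apply: subset_leq_card.
apply/subsetP => z; rewrite inE => /forallP h; apply/ffun_onP => i.
by rewrite inE; exact: h.
Qed.

Lemma card_reach_le k x (A : {set torus d n}) : {in A, forall y, reach k x y} ->
  (#|A| <= (2 * (rho * k) + 1) ^ d)%N.
Proof.
move=> hA; apply: leq_trans (card_cyclic_abs_le (rho * k)).
rewrite -[leqLHS](card_imset _ (addrI (- x))); apply: subset_leq_card.
apply/subsetP => _ /imsetP[y yA ->]; rewrite inE; apply/forallP => i.
by rewrite addrC; exact/reach_cyclic_abs/hA.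
Qed.

Definition unit_vec i : torus d n := [ffun j => inord (i == j)].

Lemma unit_vecE i j : unit_vec i j = (i == j) :> nat.
Proof. by rewrite ffunE inordK // prednK //; case: eqP. Qed.

Hypothesis hrho : (1 <= rho)%N.

(** A unit vector has norm at most 1, hence at most [rho], for every q, and n > 1 keeps it
    nonzero. *)
Lemma adj_unit_vec x i : adj x (x + unit_vec i).
Proof.
rewrite -{1}[x]addr0 adj_translate /Defs.adj subr0; apply/andP; split.
  apply/eqP => /ffunP/(_ i)/(congr1 val); rewrite -[RHS]/(unit_vec i i : nat).
  by rewrite unit_vecE eqxx ffunE.
have c j : `|(centered (unit_vec i) j)%:~R| = (i == j)%:R :> R.
  rewrite abs_centered /cyclic_abs unit_vecE; congr _%:R.
  by case: eqP => _ /=; move: hn; lia.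
have r1 : 1 <= rho%:R :> R by rewrite ler1n.
apply: le_trans r1; rewrite /torus_norm; move: hq; case: q => [p||//] hp.
  have p0 : 0 < p by rewrite (lt_le_trans ltr01) // -lee_fin.
  rewrite (bigD1 i) //= c eqxx powR1 big1 ?addr0 ?powR1 // => j ij.
  by rewrite c eq_sym (negbTE ij) powR0 // gt_eqF.
by apply/bigmax_leP; split=> // j _; rewrite c; case: eqP.
Qed.

(** Walk along the axes, with z_i unit steps in direction i. *)
Lemma reach_sum x z : reach (\sum_i z i)%N x (x + z).
Proof.
have h1 i k y : reach k y (y + unit_vec i *+ k).
  elim: k => [|k IH]; first by rewrite mulr0n addr0; exact: reach0.
  rewrite -addn1 mulrnDr addrA; apply: reach_trans IH (reach_step _).
  by rewrite mulr1n; exact: adj_unit_vec.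
have h2 (s : seq 'I_d) y : reach (\sum_(i <- s) z i)%N y (y + \sum_(i <- s) unit_vec i *+ z i).
  elim: s y => [|i s IH] y; first by rewrite !big_nil addr0; exact: reach0.
  by rewrite !big_cons addrA; apply: reach_trans (IH _); exact: h1.
have {2}-> : z = \sum_i unit_vec i *+ z i; last exact: h2.
apply/ffunP => j; rewrite sum_ffunE (bigD1 j) //= big1 => [|i ij]; last first.
  rewrite ffunMnE (_ : unit_vec i j = 0) ?mul0rn //; apply: val_inj => /=.
  by rewrite unit_vecE (negbTE ij).
rewrite addr0 ffunMnE Zp_mulrn unit_vecE eqxx mul1n.
by rewrite valZpK.
Qed.
End TorusGraph.

(** * The Gibbs measure on the torus *)

(** Transports events to sets of plus vertices, where [mass] is defined. *)
Definition plus_event (d n : nat) (A : {set config d n}) :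
    {set {set torus d n}} :=
  [set S : {set torus d n} | [ffun x => x \in S] \in A].

Section TorusIsing.
Context (R : realType) (q : \bar R) (rho r d n : nat) (a b : R).
Hypothesis hq : (1 <= q)%E.
Hypothesis hrho : (1 <= rho)%N.
Hypothesis hd : (1 <= d)%N.
Hypothesis hn : (1 < n)%N.
Hypothesis b_ge0 : 0 <= b.
Hypothesis ab_le0 : a + (degree q rho d n)%:R * b <= 0.

Local Notation T := (torus d n).
Local Notation adj := (@adj R q rho d n).
Local Notation reach := (@reach R q rho d n).
Local Notation w := (plus_weight adj a b).
Local Notation mass := (mass adj a b).
Local Notation eps := (expR (2 * (a + (degree q rho d n)%:R * b))).
Local Notation local_config := (local_config q rho r d n).

Let e_sym : symmetric adj . Proof. exact: adj_sym. Qed.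
Let e_irr : irreflexive adj . Proof. exact: adj_irr. Qed.
Let e_deg x : #|[set y | adj x y]| = degree q rho d n. Proof. exact: card_adj. Qed.

Lemma boltzmann_plus_weight : exists2 Z : R, 0 < Z &
  forall S : {set T}, boltzmann q rho a b [ffun x => x \in S] = Z * w S.
Proof.
(* This is the Boltzmann factor of the all-minus configuration, for which w = 1. *)
exists (expR (b * #|edges q rho d n|%:R - a * #|T|%:R)); first exact: expR_gt0.
move=> S; rewrite -expRD /boltzmann; congr expR.
have hS : forall x, (x \in S) = [ffun x => x \in S] x by move=> x; rewrite ffunE.
rewrite (sum_spin R hS) (sum_edge_spin R e_sym e_irr hS) -/(edges q rho d n).
by rewrite /edges -/(edge_set adj); ring.
Qed.

Lemma gibbs_cond_mass (A B : {set config d n}) :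
  gibbs_cond q rho a b A B =
  mass (plus_event A :&: plus_event B) / mass (plus_event B).
Proof.
have [Z Z0 hZ] := boltzmann_plus_weight.
have sumE (E : {set config d n}) :
    \sum_(s in E) boltzmann q rho a b s = Z * mass (plus_event E).
  rewrite (reindex (fun S : {set T} => [ffun x => x \in S] : config d n)) /=.
    by rewrite /mass mulr_sumr; apply: eq_big => [S|S _]; rewrite ?inE ?hZ.
  exists (fun s : config d n => [set x | s x]) => s _.
    by apply/setP => x; rewrite inE ffunE.
  by apply/ffunP => x; rewrite ffunE inE.
have Zt : \sum_(s : config d n) boltzmann q rho a b s != 0.
  rewrite (eq_bigl (fun s => s \in [set: config d n])) => [|s]; last first.
    by rewrite in_setT.
  rewrite sumE mulf_neq0 ?lt0r_neq0 //; apply: (@mass_gt0 _ _ _ _ _ _ set0).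
  by rewrite inE in_setT.
have -> : plus_event A :&: plus_event B = plus_event (A :&: B).
  by apply/setP => S; rewrite !inE.
rewrite /gibbs_cond /gibbs !sumE invfM invrK.
set N := mass _; set M := mass _; set t := bigop.body _ _ _ in Zt *.
(* B may have mass 0, so the inverse of its mass is kept abstract and only the common factors are
   cancelled. *)
rewrite invfM; move: (M^-1) => M'; field.
by rewrite lt0r_neq0.
Qed.

Lemma card_torus_ge : (n <= #|{: T}|)%N.
Proof.
rewrite card_ffun !card_ord prednK ?(ltnW hn) //.
by rewrite -[leqLHS]expn1 leq_pexp2l ?(ltnW hn).
Qed.

Lemma graph_dist_reach k x y : (k < n)%N ->
  reflect (reach k x y) (graph_dist q rho x y <= k)%N.
Proof. by move=> kn; apply: graph_distP; apply: leq_trans kn card_torus_ge. Qed.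

Definition tball (x : T) (k : nat) : {set T} := [set y | graph_dist q rho x y <= k]%N.

Lemma tballP k x y : (k < n)%N -> reflect (reach k x y) (y \in tball x k).
Proof. by move=> kn; rewrite inE; exact: graph_dist_reach. Qed.

(** The second radius l allows one constant to serve the balls of radius r and r + 1. *)
Lemma card_tball k l x : (k < n)%N -> (k <= l)%N ->
  (#|tball x k| <= (2 * (rho * l) + 1) ^ d)%N.
Proof.
move=> kn kl; apply: (card_reach_le hq hn) => y /(tballP _ _ kn).
exact: reachW.
Qed.

Hypothesis hr : (r < n)%N.

Definition plus_image (y : T) (zeta : local_config) : {set T} :=
  [set y + z | z in positive_vertices zeta].

(** Translation by y carries B(0, r) onto B(y, r), so the pattern prescribes exactly the plus
    vertices in that ball. *)
Lemma plus_event_occurs y (zeta : local_config) :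
  plus_event (occurs y zeta) = seen (tball y r) (plus_image y zeta).
Proof.
apply/setP => S; rewrite !inE; apply/forallP/eqP => [h|/setP h [v vr]].
  apply/setP => u; rewrite !inE; apply/idP/imsetP => [/andP[uS uy]|[v]].
    have vr : u - y \in graph_ball q rho 0 r.
      rewrite inE; apply/graph_dist_reach => //.
      by rewrite addrC -(addNr y); apply/reach_translate/graph_dist_reach.
    exists (u - y); rewrite ?subrKC //; apply/imsetP.
    exists (exist _ (u - y) vr) => //; rewrite inE.
    by have /eqP <- := h (exist _ (u - y) vr); rewrite /= ffunE subrKC.
  move=> /imsetP[[v' vr]]; rewrite inE => vz /= -> ->.
  have /eqP := h (exist _ v' vr); rewrite vz /= ffunE => -> /=.
  apply/graph_dist_reach => //; rewrite -{1}[y]addr0.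
  by apply/reach_translate/graph_dist_reach => //; have := vr; rewrite inE.
have := h (y + v); rewrite !inE /= ffunE.
have -> : (graph_dist q rho y (y + v)%R <= r)%N.
  apply/graph_dist_reach => //; rewrite -{1}[y]addr0.
  by apply/reach_translate/graph_dist_reach => //; have := vr; rewrite inE.
rewrite andbT => ->; apply/eqP; apply/imsetP/idP => [[v'']|zv].
  move=> /imsetP[v']; rewrite inE => zv' -> /addrI vv'.
  by rewrite (_ : exist _ v vr = v') //; apply: val_inj.
by exists v => //; apply/imsetP; exists (exist _ v vr); rewrite ?inE.
Qed.

Lemma plus_image_sub y (zeta : local_config) : plus_image y zeta \subset tball y r.
Proof.
apply/subsetP => _ /imsetP[_ /imsetP[[v vr] _ ->] ->]; apply/tballP => //.
rewrite -{1}[y]addr0; apply/reach_translate/graph_dist_reach => //=.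
by move: vr; rewrite inE.
Qed.

(** The perimeter is the edge cut, since each inner edge uses two of the V k arcs out of the plus
    vertices; translation preserves arcs. *)
Lemma weight_plus_image y (zeta : local_config) : weight a b zeta = w (plus_image y zeta).
Proof.
have card_im (A : {set T}) : #|[set y + z | z in A]| = #|A|.
  by rewrite card_imset //; exact: addrI.
rewrite /weight /plus_weight /plus_image card_im; congr (expR (_ - _ * _)).
set A := positive_vertices zeta.
have -> : perimeter zeta = edge_cut adj A.
  rewrite /perimeter -/A -(edge_cut_arcs e_deg) (card_arcs_edges R e_sym e_irr).
  by rewrite PoszD addrK.
rewrite -pmulrn; congr _%:R; rewrite /edge_cut.
have -> : arcs adj [set y + z | z in A] (~: [set y + z | z in A]) =
    [set (y + p.1, y + p.2) | p in arcs adj A (~: A)].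
  apply/setP => -[u v]; rewrite arcsP inE; apply/and3P/imsetP.
    move=> [/imsetP[u' uA ->] vA]; rewrite -{1}(subrKC y v) adj_translate => uv.
    exists (u', v - y); rewrite /= ?subrKC // arcsP uA uv inE andbT.
    by apply: contra vA => vA; apply/imsetP; exists (v - y); rewrite ?subrKC.
  move=> [[u' v']]; rewrite arcsP inE => /and3P[uA vA uv] [-> ->].
  rewrite adj_translate uv !(mem_imset _ _ (addrI y)) uA vA; split=> //.
by rewrite card_imset // => -[u v] [u' v'] [/addrI -> /addrI ->].
Qed.

(** The all-minus pattern has weight 1, so a weight below 1 forces a plus vertex, as
    [mass_seen_le_eps] requires. *)
Lemma plus_image_neq0 y (zeta : local_config) (W : R) :
  weight a b zeta <= W -> W < 1 -> plus_image y zeta != set0.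
Proof.
rewrite (weight_plus_image y) => h W1; apply: contraTneq h => ->.
rewrite -ltNge (lt_le_trans W1) // /plus_weight cards0 /edge_cut.
have -> : arcs adj set0 (~: set0) = set0.
  by apply/setP => -[u v]; rewrite arcsP !inE.
by rewrite cards0 !mulr0 subrr expR0.
Qed.

Lemma plus_event_occurs_gt0 x (eta : local_config) : 0 < mass (plus_event (occurs x eta)).
Proof.
apply: (@mass_gt0 _ _ _ _ _ _ (plus_image x eta)).
by rewrite plus_event_occurs inE; apply/eqP/setIidPl/plus_image_sub.
Qed.

(** * Finite-volume bounds on the conditional probability *)

Lemma tball_disjoint k l x y : (k + l < n)%N -> ~~ (graph_dist q rho x y <= k + l)%N ->
  [disjoint tball x k & tball y l].
Proof.
move=> kln; apply: contraR => /pred0Pn[u /andP[/tballP xu /tballP yu]].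
apply/graph_dist_reach => //; apply: reach_trans (xu _) _; first by lia.
by apply: reach_sym => //; apply: yu; lia.
Qed.

(** A bound on the volume of balls of radius r + 1 that does not depend on n. *)
Local Notation M := ((2 * (rho * r.+1) + 1) ^ d)%N.

Lemma card_local_config : (#|{: local_config}| <= 2 ^ M)%N.
Proof.
rewrite card_ffun card_bool card_sig leq_exp2l //.
by apply: (@card_tball r r.+1 0).
Qed.

Lemma mass_occurs2_le x y (eta zeta : local_config) (W : R) :
  (2 * r + 1 < n)%N -> weight a b zeta <= W -> W < 1 ->
  ~~ (graph_dist q rho x y <= 2 * r)%N ->
  mass (plus_event (occurs x eta) :&: plus_event (occurs y zeta)) <=
  2 ^+ M * ((if (graph_dist q rho x y <= 2 * r + 1)%N then eps else 0) + W) *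
  mass (plus_event (occurs x eta)).
Proof.
move=> rn zW W1 xy; rewrite !plus_event_occurs.
set mx := mass (seen (tball x r) _); have mx0 : 0 <= mx by exact: mass_ge0.
have W0 : 0 <= W by apply: le_trans zW; exact: expR_ge0.
have card_le k : (k < n)%N -> (k <= r.+1)%N ->
    2 ^+ #|tball y k| <= 2 ^+ M :> R.
  by move=> kn kr; rewrite ler_eXn2l ?ltr1n // card_tball.
(* At distance 2r + 1 only the balls of radius r are known to be disjoint, which gives the bound by
   [eps]; farther away B(y, r+1) also misses B(x, r) and serves as the collar. *)
case: ifP => xy1.
  have dxy : [disjoint tball y r & tball x r].
    by rewrite disjoint_sym tball_disjoint // addnn -mul2n //; lia.
  have Z0 : plus_image y zeta != set0 by exact: plus_image_neq0 zW W1.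
  have := mass_seen_le_eps e_sym e_deg b_ge0 ab_le0 (off_seen (plus_image x eta) dxy) Z0.
  move=> /le_trans; apply.
  rewrite -/mx ler_wpM2r // ler_pM ?exprn_ge0 ?expR_ge0 ?card_le //; try lia.
  by rewrite lerDl.
have dxy : [disjoint tball y r.+1 & tball x r].
  rewrite disjoint_sym tball_disjoint //; first by lia.
  by rewrite addnS addnn -mul2n -addn1 xy1.
have sub : tball y r \subset tball y r.+1.
  by apply/subsetP => u; rewrite !inE => /leq_trans; apply; exact: leqnSn.
have sep : {in tball y r, forall u v, v \notin tball y r.+1 -> ~~ adj u v}.
  move=> u /tballP yu v; apply: contra => uv; apply/tballP; first by lia.
  by rewrite -addn1; apply: reach_trans (yu _) _ => //; exact: reach_step.
have := mass_seen_le_weight e_sym e_deg b_ge0 ab_le0 (plus_image y zeta)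
  (off_seen (plus_image x eta) dxy) sub sep.
move=> /le_trans; apply.
rewrite -/mx ler_wpM2r // ler_pM ?exprn_ge0 ?expR_ge0 ?card_le //; try lia.
by rewrite -(weight_plus_image y) add0r.
Qed.

(** Union bound over centers and patterns. One factor 2^M counts the patterns, the other comes from
    [mass_occurs2_le]; the two volumes count the centers within 2r + 1 and those within s. *)
Lemma gibbs_cond_light_le x (eta : local_config) (s : nat) (W : R) :
  (2 * r + 1 < n)%N -> (s < n)%N -> 0 <= W < 1 ->
  gibbs_cond q rho a b (light_nearby q rho r a b x s W) (occurs x eta) <=
  2 ^+ M * 2 ^+ M * (((2 * (rho * (2 * r + 1)) + 1) ^ d)%:R * eps +
                     ((2 * (rho * s) + 1) ^ d)%:R * W).
Proof.
move=> rn sn /andP[W0 W1]; rewrite gibbs_cond_mass setIC.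
rewrite ler_pdivrMr ?plus_event_occurs_gt0 //.
set mx := mass (plus_event (occurs x eta)).
have mx0 : 0 <= mx by exact: mass_ge0.
set ring := graph_ring q rho x (2 * r) (s - r).
set light := light_configs q rho r d n a b W.
have -> : plus_event (light_nearby q rho r a b x s W) =
    \bigcup_(p | (p.1 \in ring) && (p.2 \in light)) plus_event (occurs p.1 p.2).
  apply/setP => S; rewrite !inE; apply/existsP/bigcupP.
    move=> [y /andP[yr /existsP[zeta /andP[zl yz]]]]; exists (y, zeta).
      by rewrite yr zl.
    by rewrite inE.
  move=> [[y zeta] /andP[yr zl] yz]; exists y; rewrite yr /=; apply/existsP.
  by exists zeta; rewrite zl; move: yz; rewrite inE.
apply: le_trans (mass_bigcup _ _ _ _ _ _) _.
pose c y := (if (graph_dist q rho x y <= 2 * r + 1)%N then eps else 0) + W.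
have c0 y : 0 <= c y by rewrite addr_ge0 //; case: ifP; rewrite ?expR_ge0.
apply: (@le_trans _ _ (\sum_(p | (p.1 \in ring) && (p.2 \in light))
    2 ^+ M * c p.1 * mx)).
  apply: ler_sum => -[y zeta] /= /andP[]; rewrite !inE => /andP[yr _] zl.
  by apply: mass_occurs2_le => //; rewrite -ltnNge.
rewrite -(pair_big_dep (mem ring) (fun _ z => z \in light) (fun y _ => 2 ^+ M * c y * mx)) /=.
apply: (@le_trans _ _ (\sum_(y in ring) 2 ^+ M * (2 ^+ M * c y * mx))).
  apply: ler_sum => y _; rewrite sumr_const -[leLHS]mulr_natl ler_wpM2r //.
    by rewrite !mulr_ge0 ?exprn_ge0.
  rewrite -natrX ler_nat; apply: leq_trans card_local_config; exact: max_card.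
rewrite -mulr_sumr -mulr_suml -mulr_sumr !mulrA ler_wpM2r // -!mulrA.
rewrite !ler_pM2l ?exprn_gt0 // big_split /= lerD //.
  rewrite -big_mkcondr sumr_const -[leLHS]mulr_natl ler_wpM2r ?expR_ge0 // ler_nat.
  apply: leq_trans (card_tball x rn (leqnn _)); apply: subset_leq_card.
  by apply/subsetP => y; rewrite !inE => /andP[].
rewrite sumr_const -[leLHS]mulr_natl ler_wpM2r // ler_nat.
apply: leq_trans (card_tball x sn (leqnn _)); apply: subset_leq_card.
apply/subsetP => y; rewrite !inE => /andP[_ /leq_trans]; apply; exact: leq_subr.
Qed.

Lemma gibbs_cond_le1 (A B : {set config d n}) : gibbs_cond q rho a b A B <= 1.
Proof.
rewrite gibbs_cond_mass.
have := mass_ge0 adj a b (plus_event B); rewrite le_eqVlt => /orP[/eqP <-|m0].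
  by rewrite invr0 mulr0.
by rewrite ler_pdivrMr // mul1r massS // subsetIr.
Qed.

Lemma gibbs_cond_ge0 (A B : {set config d n}) : 0 <= gibbs_cond q rho a b A B.
Proof. by rewrite gibbs_cond_mass divr_ge0 ?mass_ge0. Qed.

(** The pattern is sought at J^d grid points with offsets in {m, 2m, ..., Jm}^d, where m = 2 rho r +
    1. Axis walks of length at most d m J keep them within s - r of x. *)
Lemma gibbs_cond_light_ge x (eta zeta : local_config) (s J : nat) (W : R) :
  (2 * rho * s < n)%N -> (2 * r + 1 < n)%N -> (d * ((2 * rho * r + 1) * J) <= s - r)%N ->
  weight a b zeta = W -> W <= 1 ->
  1 - (1 - W / 2 ^+ M) ^+ (J ^ d) <=
  gibbs_cond q rho a b (light_nearby q rho r a b x s W) (occurs x eta).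
Proof.
set m := (2 * rho * r + 1)%N => sn rn Js zW W1.
have mJ : (2 * (m * J) < n)%N.
  have : (m * J <= d * (m * J))%N by rewrite leq_pmull.
  have : (s <= rho * s)%N by rewrite leq_pmull.
  by move: sn; rewrite -mulnA; lia.
(* The spacing [m] exceeds [rho * 2r], hence the balls are disjoint; the bound
   [2 m J < n] prevents wrapping around the torus. *)
pose z (j : {ffun 'I_d -> 'I_J}) : T := [ffun i => inord (m * (j i).+1)].
have zE j i : z j i = (m * (j i).+1)%N :> nat.
  rewrite ffunE inordK // prednK ?(ltnW hn) //.
  have : (m * (j i).+1 <= m * J)%N by rewrite leq_mul2l ltn_ord orbT.
  by lia.
have z_ge j i : (m <= z j i <= m * J)%N.
  by rewrite zE leq_mul2l ltn_ord orbT andbT leq_pmulr.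
(* The first coordinate lies between m and m J < n/2, so its cyclic size is at least m > 2 rho r. *)
have far j : ~~ (graph_dist q rho x (x + z j)%R <= 2 * r)%N.
  apply/negP => /graph_dist_reach h; have {}h : reach (2 * r) x (x + z j) by apply: h; lia.
  have := reach_cyclic_abs hq hn (Ordinal hd) h.
  rewrite addrAC subrr add0r /cyclic_abs; have := z_ge j (Ordinal hd).
  by rewrite {1}/m; lia.
have close j : (graph_dist q rho x (x + z j)%R <= s - r)%N.
  apply/graph_dist_reach; first by nia.
  apply: reachW (reach_sum hq hn hrho x (z j)); apply: leq_trans Js.
  rewrite -[X in (X * _)%N]card_ord -sum_nat_const; apply: leq_sum => i _.
  by have /andP[] := z_ge j i.
(* In a coordinate where j and k differ, the offsets differ by at least m and by less than n/2, so
   the cyclic difference is at least m too. *)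
have apart j k : j != k ->
    ~~ (graph_dist q rho (x + z j)%R (x + z k)%R <= 2 * r)%N.
  move=> jk; have [i ijk] : exists i, j i != k i.
    by apply/existsP; apply: contraNT jk; rewrite negb_exists => /forallP h;
      apply/eqP/ffunP => i; apply/eqP; have := h i; rewrite negbK.
  apply/negP => /graph_dist_reach h.
  have {}h : reach (2 * r) (x + z j) (x + z k) by apply: h; lia.
  have := reach_cyclic_abs hq hn i h.
  rewrite opprD addrACA subrr add0r /cyclic_abs torusDE // torusNE //.
  have := z_ge j i; have := z_ge k i.
  have : (z j i + m <= z k i \/ z k i + m <= z j i)%N.
    rewrite !zE -!mulnSr !leq_mul2l; move: ijk; rewrite -val_eqE neq_ltn /=.
    by move=> /orP[jk'|kj']; [left|right]; apply/orP; right.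
  move: (z j i : nat) (z k i : nat) => u v uv vJ uJ.
  rewrite (modn_small (m := n - u)); last by move: uJ; rewrite {1}/m; lia.
  have m_gt : (2 * (rho * r) < m)%N by rewrite /m; lia.
  have [vu|uv'] := ltnP v u; first by rewrite modn_small; lia.
  have -> : ((v + (n - u)) %% n = v - u)%N.
    have -> : (v + (n - u) = v - u + n)%N by lia.
    by rewrite modnDr modn_small; lia.
  lia.
pose B j := tball (x + z j) r; pose Z j := plus_image (x + z j) zeta.
set Ev := plus_event (occurs x eta); have Ev0 : 0 < mass Ev := plus_event_occurs_gt0 x eta.
(* Pass to the complement: with no light pattern in the ring, every grid ball misses [zeta]. *)
rewrite gibbs_cond_mass setIC mass_compl mulrBl divff ?gt_eqF // lerD2l lerN2.
rewrite ler_pdivrMr //.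
apply: (@le_trans _ _ (mass (Ev :&:
    [set A | all (fun j => A \notin seen (B j) (Z j)) (enum {ffun 'I_d -> 'I_J})]))).
  apply: massS; apply/subsetP => S; rewrite in_setD in_setI => /andP[SE ->] /=.
  rewrite inE; apply/allP => j _; apply: contra SE => jS.
  rewrite inE inE; apply/existsP; exists (x + z j); apply/andP; split.
    by rewrite inE close ltnNge far.
  apply/existsP; exists zeta; rewrite inE zW lexx /=.
  by have := plus_event_occurs (x + z j) zeta => /setP/(_ S); rewrite inE => ->.
have -> : (J ^ d)%N = size (enum {ffun 'I_d -> 'I_J}).
  by rewrite -cardE card_ffun !card_ord.
apply: (mass_unseen_le e_sym e_deg b_ge0 ab_le0).
- exact: enum_uniq.
- by move=> j k _ _ jk; apply: tball_disjoint; rewrite addnn -mul2n ?apart //; lia.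
- move=> j _; split.
  + rewrite /Ev plus_event_occurs; apply: off_seen; rewrite disjoint_sym.
    by apply: tball_disjoint; rewrite addnn -mul2n ?far //; lia.
  + exact: plus_image_sub.
  + by rewrite -weight_plus_image zW.
  + by rewrite card_tball.
- by rewrite W1 -zW expR_ge0.
Qed.
End TorusIsing.

(** * Exponential estimates and the two limits *)

Lemma expR_oppM_cvg0 (R : realType) (c : R) : 0 < c ->
  (expR (- (c * x)) @[x --> +oo] --> (0 : R))%classic.
Proof.
move=> c0; have h : (c * x @[x --> +oo] --> +oo)%classic by exact: gt0_cvgMry c0 cvg_id.
exact: (@cvg_comp _ _ _ (fun x => c * x) (fun y : R => expR (- y)) _ _ _ h (@cvgr_expR R)).
Qed.

Lemma one_subr_exp_le (R : realType) (p : R) (N : nat) : p <= 1 ->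
  (1 - p) ^+ N <= expR (- (p * N%:R)).
Proof.
move=> p1; rewrite -mulNr mulrC expRM_natl lerXn2r ?nnegrE ?subr_ge0 ?expR_ge0 //.
exact: expR_ge1Dx.
Qed.

Lemma powRV_exprn (R : realType) (d : nat) (x : R) : (0 < d)%N -> 0 <= x ->
  (x `^ d%:R^-1) ^+ d = x.
Proof.
move=> d0 x0; rewrite -powR_mulrn ?powR_ge0 // -powRrM mulVf ?powRr1 //.
by rewrite pnatr_eq0 -lt0n.
Qed.

Local Open Scope classical_set_scope.
Local Open Scope ring_scope.

Theorem theorem5p3 (R : realType) (d : nat) (q : \bar R) (rho r : nat)
    (hd : (1 <= d)%N) (hq : (1 <= q)%E) (hrho : (1 <= rho)%N) (hr : (1 <= r)%N)
    (n0 : nat) (rad : nat -> nat)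
    (hrad_lt : forall n, (n0 <= n)%N -> (2 * rho * rad n < n)%N)
    (hrad_ge : forall n, (n0 <= n)%N -> (3 * r + 1 <= rad n)%N)
    (eta : forall n, local_config q rho r d n)
    (heta_same : forall m n, (n0 <= m)%N -> (n0 <= n)%N ->
       same_local_config (eta m) (eta n))
    (heta_pos : forall n, (n0 <= n)%N -> (0 < #|positive_vertices (eta n)|)%N)
    (a b : nat -> R) (lambda : R)
    (ha : forall n, (n0 <= n)%N -> a n < 0)
    (hb : forall n, (n0 <= n)%N -> 0 <= b n)
    (hlambda : 0 < lambda)
    (hweight : forall n, (n0 <= n)%N ->
       n%:R ^+ d * weight (a n) (b n) (eta n) = lambda)
    (hab : forall n, (n0 <= n)%N ->
       a n + 2 * (degree q rho d n)%:R * b n <= 0)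
    (hab_lim : a n + (degree q rho d n)%:R * b n @[n --> \oo] --> -oo)
    (hrad_lim : rad n @[n --> \oo] --> \oo)
    (W : nat -> R)
    (hW01 : forall n, (n0 <= n)%N -> 0 < W n < 1)
    (hW_lim : W n @[n --> \oo] --> (0 : R))
    (hW_attained : forall n, (n0 <= n)%N ->
       exists zeta : local_config q rho r d n, W n = weight (a n) (b n) zeta)
    (x : forall n, torus d n) :
  ((rad n)%:R * W n `^ d%:R^-1 @[n --> \oo] --> (0 : R) ->
   gibbs_cond q rho (a n) (b n)
     (light_nearby q rho r (a n) (b n) (x n) (rad n) (W n))
     (occurs (x n) (eta n)) @[n --> \oo] --> (0 : R)) /\
  ((rad n)%:R * W n `^ d%:R^-1 @[n --> \oo] --> +oo ->
   gibbs_cond q rho (a n) (b n)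
     (light_nearby q rho r (a n) (b n) (x n) (rad n) (W n))
     (occurs (x n) (eta n)) @[n --> \oo] --> (1 : R)).
Proof.
set V := fun n => (degree q rho d n)%:R : R.
set M := ((2 * (rho * r.+1) + 1) ^ d)%N.
have n_big n : (n0 <= n)%N -> [/\ (1 < n)%N, (r < n)%N, (2 * r + 1 < n)%N & (rad n < n)%N].
  move=> n0n; have := hrad_lt n n0n; have := hrad_ge n n0n.
  by split; nia.
have ab_le0 n : (n0 <= n)%N -> a n + V n * b n <= 0.
  move=> n0n; apply: le_trans (hab n n0n); rewrite lerD2l -mulrA mulr_natl mulr2n.
  by rewrite lerDl mulr_ge0 ?hb.
have W_pow n : (n0 <= n)%N -> ((rad n)%:R * W n `^ d%:R^-1) ^+ d = (rad n)%:R ^+ d * W n.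
  by move=> /hW01 /andP[/ltW W0 _]; rewrite exprMn powRV_exprn.
split=> hlim.
- pose K2 := ((2 * (rho * (2 * r + 1)) + 1) ^ d)%N.
  (* The factor 3 rho comes from 2 rho R + 1 <= 3 rho R, which makes the second term a multiple of
     the d-th power of R W^(1/d). *)
  pose h n := 2 ^+ M * 2 ^+ M * (K2%:R * expR (2 * (a n + V n * b n)) +
    (3 * rho%:R) ^+ d * ((rad n)%:R * W n `^ d%:R^-1) ^+ d) : R.
  apply: (@squeeze_cvgr _ _ _ _ (fun=> 0) h); last 2 first.
  + exact: cvg_cst.
  + have eps0 : expR (2 * (a n + V n * b n)) @[n --> \oo] --> (0 : R).
      under eq_fun do rewrite -[2 * _]opprK -mulrN.
      apply: (cvg_comp (fun n => - (a n + V n * b n)) (fun x => expR (- (2 * x)))).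
        exact/cvgNry.
      exact: expR_oppM_cvg0.
    have -> : 0 = 2 ^+ M * 2 ^+ M * (K2%:R * 0 + (3 * rho%:R) ^+ d * 0 ^+ d) :> R.
      by rewrite expr0n gtn_eqF // !mulr0 addr0 mulr0.
    apply: cvgMr; apply: cvgD; apply: cvgMr => //.
    exact: (@cvg_comp _ _ _ _ (fun y : R => y ^+ d) _ _ _ hlim
      (@exprn_continuous R d 0)).
  + near=> n.
    have n0n : (n0 <= n)%N by near: n; exact: nbhs_infty_ge.
    have [n1 rn rn1 radn] := n_big n n0n.
    have /andP[W0 W1] := hW01 n n0n.
    rewrite gibbs_cond_ge0 //=.
    apply: le_trans (gibbs_cond_light_le hq hrho hd n1 (hb n n0n) (ab_le0 n n0n) rn
      (x n) (eta n) rn1 radn _) _; first by rewrite ltW.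
    rewrite ler_pM2l ?mulr_gt0 ?exprn_gt0 // lerD2l W_pow // mulrA.
    rewrite ler_pM2r // -exprMn natrX lerXn2r ?nnegrE // -!natrM ler_nat.
    by have := hrad_ge n n0n; nia.
- pose m := (2 * rho * r + 1)%N.
  (* Chosen so that J >= R / (4 d m) gives J^d W / 2^M >= c R^d W. *)
  pose c := (2 ^+ M * (4 * d * m)%:R ^+ d)^-1 : R.
  have m0 : (0 < 4 * d * m)%N by rewrite /m; nia.
  have c0 : 0 < c by rewrite invr_gt0 mulr_gt0 ?exprn_gt0 ?ltr0n.
  pose u n := (rad n)%:R * W n `^ d%:R^-1.
  apply: (@squeeze_cvgr _ _ _ _ (fun n => 1 - expR (- (c * u n))) (fun=> 1)); last 2 first.
  + rewrite -[X in _ --> X]subr0; apply: cvgB; first exact: cvg_cst.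
    exact: cvg_comp hlim (expR_oppM_cvg0 c0).
  + exact: cvg_cst.
  + near=> n.
    have n0n : (n0 <= n)%N by near: n; exact: nbhs_infty_ge.
    have [n1 rn rn1 radn] := n_big n n0n.
    have /andP[W0 W1] := hW01 n n0n.
    have u1 : 1 <= u n by near: n; move/cvgryPge : hlim; apply.
    have radM : (4 * d * m <= rad n)%N by near: n; move/cvgnyPge : hrad_lim; apply.
    rewrite gibbs_cond_le1 // andbT.
    have [zeta zW] := hW_attained n n0n.
    (* The largest grid that [gibbs_cond_light_ge] allows. *)
    pose J := ((rad n - r) %/ (d * m))%N.
    have J_le : (d * (m * J) <= rad n - r)%N.
      by rewrite mulnA mulnC /J leq_trunc_div.
    (* R >= 3r + 1 gives R - r >= 2R/3, and R >= 4 d m bounds the rounding loss d m by R/4; thus d m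
       J >= 5R/12. *)
    have J_ge : (rad n <= 4 * d * m * J)%N.
      have dm0 : (0 < d * m)%N by rewrite muln_gt0 hd /m addn1.
      have := ltn_ceil (rad n - r) dm0; rewrite -/J mulSn.
      by have := hrad_ge n n0n; move: radM; rewrite -!mulnA; lia.
    apply: le_trans (gibbs_cond_light_ge hq hrho hd n1 (hb n n0n) (ab_le0 n n0n) rn
      (x n) (eta n) (hrad_lt n n0n) rn1 J_le (esym zW) (ltW W1)).
    rewrite lerD2l lerN2; apply: le_trans (one_subr_exp_le _ _) _.
      rewrite ler_pdivrMr ?exprn_gt0 // mul1r (le_trans (ltW W1)) //.
      by rewrite exprn_ege1 // ler1n.
    rewrite ler_expR lerN2.
    have uW := W_pow n n0n.
    (* Since u >= 1, u is at most its d-th power, so the linear exponent of the squeezing function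
       suffices. *)
    apply: le_trans (_ : c * u n ^+ d <= _).
      rewrite ler_pM2l //; case: (d) hd => // k _; rewrite exprS ler_peMr //.
        by apply: le_trans u1.
      exact: exprn_ege1.
    have Jd : ((4 * d * m)%:R ^+ d)^-1 * (rad n)%:R ^+ d <= J%:R ^+ d :> R.
      rewrite ler_pdivrMl ?exprn_gt0 ?ltr0n // -exprMn -natrM.
      by rewrite lerXn2r ?nnegrE // ler_nat.
    rewrite uW /c natrX invfM [leLHS](_ : _ = W n / 2 ^+ M *
      (((4 * d * m)%:R ^+ d)^-1 * (rad n)%:R ^+ d)); last by ring.
    by rewrite ler_wpM2l // divr_ge0 ?exprn_ge0 // ltW.
Unshelve. all: by end_near.
Qed.
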